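(* Let $k$ be a field of characteristic $0$ and let $P\in k[T,X]$ have degree $n\geq 1$ in $X$ and be separable as an element of $k(T)[X]$, with nontrivial Galois group $G$ over $k(T)$. Let $\Delta(T)$ and $\ell(T)$ be the discriminant and leading coefficient of $P$ (as a polynomial in $X$). Let $M_1,\ldots,M_r$ be representatives of all the conjugacy classes of maximal subgroups of $G$. For $i=1,\ldots,r$ let $F_i$ be the fixed field of $M_i$, and let $f_i(T,X)$ be a monic irreducible polynomial in $k[T][X]$ such that $F_i/k(T)$ is generated by a root of $f_i(T,X)$. Suppose that $t\in k$ satisfies $$\Delta(t)\cdot\ell(t)\cdot\prod_{i=1}^r\operatorname{disc} f_i(t,X)\neq 0.$$ Then the following hold: (1) If $\mathcal{F}(P_t)\neq\mathcal{F}(P)$, then $G_t\not\cong G$. (2) $G_t\not\cong G$ if and only if there is an index $i$ such that $f_i(t,X)$ has a root in $k$.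
   Context: $G=\operatorname{Gal}(N/k(T))$, where $N$ is a splitting field of $P$ over $k(T)$; the fixed fields $F_i$ are subfields of $N$. For $t\in k$, $P_t=P(t,X)\in k[X]$ and $G_t$ is the Galois group of $P_t$ over $k$. The factorization type $\mathcal{F}(P)$ is the multiset of degrees of the irreducible factors of $P$ in $k(T)[X]$, and $\mathcal{F}(P_t)$ is the multiset of degrees of the irreducible factors of $P_t$ in $k[X]$. Discriminants are taken with respect to $X$. *)

(* Defs.v *)
From HB Require Import structures.
From mathcomp Require Import all_boot all_order all_algebra.
From mathcomp Require Import all_fingroup all_solvable all_field.
From mathcomp Require Import finmap multiset.

Set Implicit Arguments.
Unset Strict Implicit.
Unset Printing Implicit Defensive.

Import GRing.Theory.
Local Open Scope mset_scope.
Local Open Scope ring_scope.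

(* A polynomial P(T, X) in k[T, X] is an element of {poly {poly k}}: the outer
   variable is X and the inner one is T. *)

Notation ratfun k := {fraction {poly k}}.

Definition over_ratfun (k : fieldType) (P : {poly {poly k}}) :
    {poly (ratfun k)} :=
  map_poly (tofrac (R := {poly k})) P.

(* P(t, X) *)
Definition specialize (k : fieldType) (t : k) (P : {poly {poly k}}) :
    {poly k} :=
  map_poly (horner_eval t) P.

(* disc p = (-1)^(n(n-1)/2) a^-1 Res(p, p'), for p of degree n with leading
   coefficient a. [resultant] uses the Sylvester matrix of the actual degrees,
   so p' is required to have degree n - 1, as it does in characteristic 0. *)
Definition disc (F : fieldType) (p : {poly F}) : F :=
  (-1) ^+ 'C((size p).-1, 2) * (lead_coef p)^-1 * resultant p p^`().

(* [irreducible_poly] is based on pseudo-division, which ignores the constant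
   factors that are not invertible in the ring of coefficients; irreducibility
   in k[T][X] is the ring-theoretic notion. *)
Definition ring_irreducible (R : idomainType) (x : R) : Prop :=
  [/\ x != 0, x \isn't a GRing.unit &
      forall y z : R, x = y * z -> y \is a GRing.unit \/ z \is a GRing.unit].

Definition is_splitting_field (F : fieldType) (L : splittingFieldType F)
    (p : {poly F}) : Prop :=
  splittingFieldFor 1%VS (map_poly (in_alg L) p) {:L}%VS.

(* Stated as a relation, since no factorization algorithm is available over an
   arbitrary field; a nonzero p has exactly one factorization type A. *)
Definition factorization_type (F : fieldType) (p : {poly F})
    (A : {mset nat}) : Prop :=
  exists qs : seq {poly F},
    [/\ forall q : {poly F}, q \in qs -> irreducible_poly q,
        p %= \prod_(q <- qs) q &
        A = seq_mset [seq (size q).-1 | q : {poly F} <- qs]].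

(* The H i, i < r, are representatives of the conjugacy classes of maximal
   subgroups of G, exactly one for each class. *)
Definition maximal_class_reps (gT : finGroupType) (G : {group gT}) (r : nat)
    (H : 'I_r -> {group gT}) : Prop :=
  [/\ forall i, maximal (H i) G,
      forall K : {group gT}, maximal K G ->
        exists i, (K : {set gT}) \in (H i :^: G)%g &
      forall i j, (H i : {set gT}) \in (H j :^: G)%g -> i = j].

(* Main.v *)
Require Import Defs.
From mathcomp Require Import all_boot all_order all_algebra.
From mathcomp Require Import all_fingroup all_solvable all_field.
From mathcomp Require Import finmap multiset mpoly.
From Stdlib Require Import Classical.

Set Implicit Arguments.
Unset Strict Implicit.
Unset Printing Implicit Defensive.

Import GRing.Theory.
Local Open Scope mset_scope.
Local Open Scope ring_scope.

(** The fibre at [t] is governed by a subgroup of the generic Galois group.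
    Write [A = k[T]] and let [N] and [Nt] be the splitting fields of [P] over
    [k(T)] and of [P(t, X)] over [k]. After multiplying the roots by the leading
    coefficient they become integral over [A]; let [B] be the ring that they
    generate over [A] in [N]. The map [T |-> t] extends to a ring morphism
    [phi] from [B] to [Nt] that matches the roots of [P] with those of
    [P(t, X)] ([extend_specialization]). If no such extension existed, every
    matching of the roots would break some relation between the roots of [P];
    one relation [h] broken by all the matchings exists by genericity, and its
    norm, the product of its images under all permutations of the variables, is
    symmetric: it vanishes on the roots of [P], hence so does its
    specialization on the roots of [P(t, X)], a contradiction.

    Any automorphism [u] of [Nt] is induced through [phi] by some [s] in the
    Galois group [G] of [N] ([exists_compatible]), and since the roots of
    [P(t, X)] are distinct, [s] is unique and determines [u]. So [Gt] is
    isomorphic to a subgroup [D] of [G], acting on the matched roots in the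
    same way ([decomposition_group]). As [G] is finite, [Gt] is isomorphic to
    [G] exactly when [D = G].

    If [D = G], matched roots have orbits of equal size, so equal degrees over
    [k(T)] and [k]; and a factorization type is determined by the degrees of
    the roots ([count_roots_of_degree]). This gives the first claim.

    For the second, [D] is proper iff it lies in a conjugate of some [M i], iff
    [D] fixes a conjugate [g a] of the root [a] of [f i] that generates the
    fixed field of [M i]. By Gauss's lemma the conjugates of [a] are the roots
    of [f i] ([irreducible_minPoly]). They need not lie in [B], but because the
    images under [phi] of the conjugates of a suitable element of [B] are
    distinct, Lagrange interpolation writes them as fractions over [B] whose
    denominators survive [phi] ([integral_fraction]). So they reduce to the
    roots of [f i(t, X)], which are distinct, and this reduction is equivariant:
    [g a] is fixed by [D] iff its reduction is fixed by [Gt], that is, iff it is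
    a root of [f i(t, X)] in [k] ([residual_root]).

    All of this is done for an integrally closed domain [A] with a morphism to
    [k] ([specialized_galois_group]). *)

(** * Simultaneous non-vanishing in characteristic zero *)

Lemma pchar0_nat_nonroot (L : idomainType) (p : {poly L}) :
  [pchar L] =i pred0 -> p != 0 -> exists m : nat, p.[m%:R] != 0.
Proof.
move=> /pcharf0P char0 p_neq0; apply: NNPP => no_m.
have roots m : root p m%:R by apply: contra_notT no_m; exists m.
suff uniq_nat : uniq [seq m%:R : L | m <- iota 0 (size p)].
  suff all_roots : all (root p) [seq m%:R : L | m <- iota 0 (size p)].
    have := max_poly_roots p_neq0 all_roots uniq_nat.
    by rewrite size_map size_iota ltnn.
  by apply/allP => _ /mapP[m _ ->].
rewrite map_inj_uniq ?iota_uniq // => i j.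
wlog le_ij : i j / (i <= j)%N => [IH|] eq_ij.
  by case/orP: (leq_total i j) => /IH; [apply | move=> ->].
apply/eqP; rewrite eqn_leq le_ij -subn_eq0 -char0 natrB // eq_ij subrr.
exact: eqxx.
Qed.

(** Genericity: a set closed under addition is not covered by the kernels of
    finitely many additive maps unless one of them contains it. With [v] good
    for all but one map and [w] good for that one, some [w + v *+ m] is good for
    all, since each map excludes at most one [m]. *)
Lemma additive_simultaneous_nonzero (I : eqType) (V : zmodType)
    (L : idomainType) (lam : I -> V -> L) (S : V -> Prop) (r : seq I) :
    [pchar L] =i pred0 ->
    (forall i, {morph lam i : u v / u + v}) ->
    S 0 -> (forall u v, S u -> S v -> S (u + v)) ->
    (forall i, i \in r -> exists2 v, S v & lam i v != 0) ->
  exists2 v, S v & {in r, forall i, lam i v != 0}.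
Proof.
move=> char0 lamD S0 SD; elim: r => [|i0 r IHr] exr; first by exists 0.
have [|v Sv v_neq0] := IHr; first by move=> i ri; apply: exr; rewrite inE ri orbT.
have [w Sw w_neq0] := exr _ (mem_head _ _).
have lam0 i : lam i 0 = 0 by apply: (addrI (lam i 0)); rewrite -lamD !addr0.
have lamMn i m : lam i (v *+ m) = lam i v *+ m.
  by elim: m => [|m IHm]; rewrite ?mulr0n // !mulrS lamD IHm.
have SMn m : S (v *+ m) by elim: m => // m IHm; rewrite mulrS; apply: SD.
(* m is good for all maps iff it is not a root of p *)
pose p := \prod_(i <- i0 :: r) ((lam i w)%:P + lam i v *: 'X).
have p_neq0 : p != 0.
  rewrite prodf_seq_neq0; apply/allP => i /=; rewrite inE => ri.
  apply/eqP => /polyP eq0; have := eq0 0%N; have := eq0 1%N.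
  rewrite !coefE /= mulr1 mulr0 add0r addr0 => v0 w0.
  case/predU1P: ri => [eq_i|/v_neq0]; last by rewrite v0 eqxx.
  by rewrite -eq_i w0 eqxx in w_neq0.
have [m] := pchar0_nat_nonroot char0 p_neq0.
rewrite horner_prod prodf_seq_neq0 => /allP nz_m.
exists (w + v *+ m) => [|i ri]; first exact: SD.
by have /= := nz_m i ri; rewrite !hornerE lamD lamMn mulr_natr.
Qed.

(** * Extending a specialization to the roots of a polynomial *)

Lemma rmorph_mpolyE n (A : comNzRingType) (B : comNzRingType)
    (g : {rmorphism {mpoly A[n]} -> B}) (nu : {rmorphism A -> B}) p :
  (forall a, g a%:MP = nu a) -> g p = mmap nu (fun i => g 'X_i) p.
Proof.
move=> gC; rewrite {1}[p]mpolyE raddf_sum /=; apply: eq_bigr => m _.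
by rewrite -mul_mpolyC rmorphM gC /= mpolyXE_id rmorph_prod; congr (_ * _);
  apply: eq_bigr => i _; rewrite rmorphXn.
Qed.

Lemma mmap_mesym n (A B : comNzRingType) (nu : {rmorphism A -> B}) h k :
  mmap nu h (mesym n A k) = (mesym n B k).@[h].
Proof.
rewrite /mesym !raddf_sum /=; apply: eq_bigr => I _; rewrite !rmorph_prod /=.
by apply: eq_bigr => i _; rewrite mmapX mmap1U mevalXU.
Qed.

Section ExtendSpecialization.

Variables (A : idomainType) (F1 F2 : fieldType).
Variables (nu1 : {rmorphism A -> F1}) (nu2 : {rmorphism A -> F2}).
Variables (n : nat) (Q : {poly A}) (x : n.-tuple F1) (y : n.-tuple F2).
Hypothesis splitx : map_poly nu1 Q = \prod_(c <- x) ('X - c%:P).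
Hypothesis splity : map_poly nu2 Q = \prod_(c <- y) ('X - c%:P).

(** The value is a polynomial in the coefficients of [Q], hence is computed by
    the same [c] on both sides. *)
Lemma symmetric_value_in_base (S : {mpoly A[n]}) : S \is symmetric ->
  exists c, mmap nu1 (tnth x) S = nu1 c /\ mmap nu2 (tnth y) S = nu2 c.
Proof.
case/sym_fundamental => U [<- _].
(* by Viete, e i is the elementary symmetric function of degree i + 1 *)
pose e (i : 'I_n) := (-1) ^+ i.+1 * Q`_(n - i.+1).
have value (F : fieldType) (nu : {rmorphism A -> F}) (z : n.-tuple F) :
    map_poly nu Q = \prod_(c <- z) ('X - c%:P) ->
    mmap nu (tnth z) (U \mPo [tuple mesym n A i.+1 | i < n]) = nu U.@[e].
  move=> split_z; rewrite /comp_mpoly.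
  pose g : {rmorphism {mpoly A[n]} -> F} :=
    mmap nu (tnth z)
      \o mmap (@mpolyC n A) (tnth [tuple mesym n A i.+1 | i < n]).
  have gC a : g a%:MP = nu a by rewrite /g /= !mmapC.
  pose g' : {rmorphism {mpoly A[n]} -> F} := nu \o meval e.
  have g'C a : g' a%:MP = nu a by rewrite /g' /= mevalC.
  rewrite -[LHS]/(g U) -[RHS]/(g' U) (rmorph_mpolyE U gC) (rmorph_mpolyE U g'C).
  rewrite /mmap; apply: eq_bigr => m _; congr (_ * _).
  apply: eq_bigr => i _; congr (_ ^+ _).
  rewrite /g /g' /= mmapX mmap1U tnth_mktuple mevalXU mmap_mesym /e.
  have lt_in : (i.+1 < n.+1)%N by rewrite ltnS.
  have := mroots_coeff z (Ordinal lt_in).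
  rewrite -split_z coef_map /= => eq_coef.
  rewrite rmorphM eq_coef rmorphXn rmorphN1 mulrA.
  by rewrite -exprMn mulrNN mul1r expr1n mul1r.
by exists U.@[e]; rewrite !(value _ _ _ splitx, value _ _ _ splity).
Qed.

(** Sending [x] to a suitable reordering of [y] extends [nu1 a |-> nu2 a] to a
    morphism on the ring generated by the roots. If every reordering broke a
    relation of [x], a generic sum of these relations would be broken by all of
    them, and its norm would have incompatible values at [x] and [y]. *)
Lemma extend_specialization : injective nu1 -> [pchar F2] =i pred0 ->
  exists s : 'S_n, forall h : {mpoly A[n]},
    mmap nu1 (tnth x) h = 0 -> mmap nu2 (fun i => tnth y (s i)) h = 0.
Proof.
move=> inj1 char0; apply: NNPP => no_s.
pose lam (s : 'S_n) (h : {mpoly A[n]}) := mmap nu2 (fun i => tnth y (s i)) h.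
have [h h0 h_neq0] : exists2 h : {mpoly A[n]}, mmap nu1 (tnth x) h = 0 &
    {in enum 'S_n, forall s, lam s h != 0}.
  apply: additive_simultaneous_nonzero => //.
  - by move=> s u v; apply: raddfD.
  - exact: raddf0.
  - by move=> u v u0 v0; rewrite raddfD /= u0 v0 addr0.
  move=> s _; apply: NNPP => no_h; apply: no_s; exists s => h h0.
  by apply/eqP; apply: contra_notT no_h; exists h.
(* the norm of h: its value is zero at x and nonzero at y *)
pose S := \prod_(s : 'S_n) msym s h.
have symS : S \is symmetric.
  apply/issymP => s; rewrite /S rmorph_prod /= [RHS](reindex_inj (mulIg s)) /=.
  by apply: eq_bigr => u _; rewrite msymMm.
have [c [c1 c2]] := symmetric_value_in_base symS.
have c0 : c = 0.
  by apply: inj1; rewrite -c1 rmorph0 /S (bigD1 1%g) //= rmorphM /= msym1m h0 mul0r.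
move/eqP: c2; rewrite c0 rmorph0 /S rmorph_prod; apply/negP.
apply/prodf_neq0 => s _ /=.
pose g : {rmorphism {mpoly A[n]} -> F2} := mmap nu2 (tnth y) \o msym s.
have gC a : g a%:MP = nu2 a by rewrite /g /= /msym !mmapC.
suff gE : g h = lam s h.
  by rewrite -[X in X != 0]/(g h) gE; apply: h_neq0; rewrite mem_enum.
rewrite (rmorph_mpolyE h gC); apply: eq_bigr => m _; congr (_ * _).
by apply: eq_bigr => i _; rewrite /g /= /msym !(mmapX, mmap1U).
Qed.

End ExtendSpecialization.

(** * Integral closedness of k[T] *)

Lemma fraction_poly_coprime (k : fieldType) (q : ratfun k) :
  exists a b : {poly k}, [/\ b != 0, coprimep b a & q * tofrac b = tofrac a].
Proof.
have [a0 [b0 [nz_b0 q_eq]]] :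
    exists a b : {poly k}, b != 0 /\ q * tofrac b = tofrac a.
  elim/quotW: q => r; exists (\n_r), (\d_r); split; first exact: denom_ratioP.
  rewrite /tofrac; unlock FracField.tofrac.
  rewrite -[LHS]FracField.pi_mul /FracField.mulf.
  rewrite !numden_Ratio ?oner_neq0 // mulr1.
  apply/eqmodP; rewrite /= FracField.equivfE.
  by rewrite !numden_Ratio ?oner_neq0 ?denom_ratioP // mulr1 mulrC.
pose g := gcdp a0 b0.
have nz_g : g != 0 by rewrite gcdp_eq0 negb_and nz_b0 orbT.
have a0E : a0 = a0 %/ g * g by rewrite divpK // dvdp_gcdl.
have b0E : b0 = b0 %/ g * g by rewrite divpK // dvdp_gcdr.
exists (a0 %/ g), (b0 %/ g); split.
- by apply: contraNneq nz_b0 => b_0; rewrite b0E b_0 mul0r.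
- by rewrite coprimep_sym coprimep_div_gcd // nz_b0 orbT.
have nz_gF : tofrac g != 0 :> ratfun k by rewrite tofrac_eq0.
by apply: (mulIf nz_gF); rewrite -mulrA -!tofracM -b0E -a0E.
Qed.

(** The rational root argument: in lowest terms, the denominator of an integral
    fraction divides a power of its numerator. *)
Lemma poly_integrally_closed (k : fieldType) (q : ratfun k) :
  integralOver (tofrac (R := {poly k})) q -> exists c, q = tofrac c.
Proof.
case=> p mon_p; have [a [b [nz_b co_ba q_eq]]] := fraction_poly_coprime q.
pose d := (size p).-1.
have szp : size p = d.+1 by rewrite prednK // size_poly_gt0 monic_neq0.
rewrite /root horner_coef size_map_poly_id0; last first.
  by rewrite (monicP mon_p) rmorph1 oner_neq0.
rewrite szp => /eqP pq0.
have dvd_b : b %| a ^+ d.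
  (* the equation of q, multiplied by the d-th power of its denominator *)
  have : \sum_(i < d.+1) p`_i * a ^+ i * b ^+ (d - i) = 0.
    apply/eqP; rewrite -tofrac_eq0 rmorph_sum /=; apply/eqP.
    transitivity (tofrac b ^+ d * 0 : ratfun k); last exact: mulr0.
    rewrite -[X in _ * X]pq0 mulr_sumr; apply: eq_bigr => i _.
    rewrite coef_map /= !rmorphM !rmorphXn /= -q_eq exprMn.
    have le_id : (i <= d)%N by rewrite -ltnS.
    have -> : tofrac b ^+ d = tofrac b ^+ i * tofrac b ^+ (d - i).
      by rewrite -exprD subnKC.
    by rewrite mulrA -[LHS]mulrA [LHS]mulrC -!mulrA; congr (_ * _);
      rewrite mulrC -!mulrA mulrCA.
  rewrite big_ord_recr /= subnn expr0 mulr1.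
  have -> : p`_d = 1 by rewrite -[d]/(size p).-1; apply/monicP.
  rewrite mul1r addrC => /eqP; rewrite addr_eq0 => /eqP ->.
  rewrite dvdpNr; apply: (big_ind (dvdp b)) => [|u v|i _]; rewrite ?dvdp0 //.
    exact: dvdp_add.
  apply: dvdp_mull.
  by rewrite -(subnSK (ltn_ord i)) exprS dvdp_mulIl.
have /size_poly1P[c nz_c bE] : size b == 1%N.
  have /eqp_size <- := dvdp_gcd_idl dvd_b.
  by rewrite -coprimep_def coprimep_expr.
exists (a * c^-1%:P); rewrite tofracM -q_eq bE -mulrA -tofracM -polyCM divff //.
by rewrite tofrac1 mulr1.
Qed.

(** * Integral coefficients and Galois descent *)

Section IntegralCoefficients.

Variables (R K : comNzRingType) (g : {rmorphism R -> K}).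

Definition integral_coefs (p : {poly K}) := forall l, integralOver g p`_l.

Lemma integral_coefsC c : integralOver g c -> integral_coefs c%:P.
Proof. by move=> int_c l; rewrite coefC; case: eqP => // _; apply: integral0. Qed.

Lemma integral_coefsX : integral_coefs 'X.
Proof. by move=> l; rewrite coefX; apply: integral_nat. Qed.

Lemma integral_coefsB p q :
  integral_coefs p -> integral_coefs q -> integral_coefs (p - q).
Proof. by move=> int_p int_q l; rewrite coefB; apply: integral_sub. Qed.

Lemma integral_coefsM p q :
  integral_coefs p -> integral_coefs q -> integral_coefs (p * q).
Proof.
move=> int_p int_q l; rewrite coefM; apply: big_ind => [|u v|m _].
- exact: integral0.
- exact: integral_add.
- exact: integral_mul.
Qed.

Lemma integral_coefs_prod (I : Type) (r : seq I) (P : pred I) p_ :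
  (forall m, P m -> integral_coefs (p_ m)) ->
  integral_coefs (\prod_(m <- r | P m) p_ m).
Proof.
move=> int_p; apply: big_ind => // [|p q]; last exact: integral_coefsM.
exact/integral_coefsC/integral1.
Qed.

Lemma integral_coefs_sum (I : Type) (r : seq I) (P : pred I) p_ :
  (forall m, P m -> integral_coefs (p_ m)) ->
  integral_coefs (\sum_(m <- r | P m) p_ m).
Proof.
move=> int_p; apply: big_ind => // [|p q int_p' int_q l].
  exact/integral_coefsC/integral0.
by rewrite coefD; apply: integral_add.
Qed.

End IntegralCoefficients.

Lemma gal_full (F : fieldType) (L : splittingFieldType F) :
  'Gal({:L} / 1%AS)%g = [set: gal_of {:L}].
Proof. by apply/setP => s; rewrite inE gal_kHom ?sub1v // k1AHom. Qed.

Section GaloisDescent.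

Variables (A : comNzRingType) (F : fieldType) (i : {rmorphism A -> F}).
Hypothesis closedA : forall q, integralOver i q -> exists a, q = i a.
Variables (N : splittingFieldType F) (galN : galois 1 {:N}).

Definition base_emb : {rmorphism A -> N} := in_alg N \o i.

Lemma map_base_emb p : map_poly base_emb p = map_poly (in_alg N) (map_poly i p).
Proof. exact: map_poly_comp. Qed.

Lemma gal_base (s : gal_of {:N}) a : s (base_emb a) = base_emb a.
Proof. exact: rmorph_alg. Qed.

Lemma map_gal_base (s : gal_of {:N}) p :
  map_poly s (map_poly base_emb p) = map_poly base_emb p.
Proof. by rewrite -map_poly_comp; apply: eq_map_poly => a /=; rewrite gal_base. Qed.

Lemma integral_gal (s : gal_of {:N}) w :
  integralOver base_emb w -> integralOver base_emb (s w).
Proof.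
by case=> p mon_p pw0; exists p => //; rewrite -(map_gal_base s) rmorph_root.
Qed.

(** Invariance puts [w] in the fraction field, integrality puts it in [A]. *)
Lemma galois_descent w : integralOver base_emb w ->
  (forall s : gal_of {:N}, s w = w) -> exists a, w = base_emb a.
Proof.
case=> p mon_p pw0 fix_w.
have : w \in fixedField 'Gal({:N} / 1%AS)%g by apply/fixedFieldP; rewrite ?memvf.
rewrite (galois_fixedField galN) => /vlineP[c wE].
have [|a cE] := closedA (q := c); last by exists a; rewrite wE cE.
by exists p => //; move: pw0; rewrite map_poly_comp wE fmorph_root.
Qed.

Lemma galois_descent_poly p : integral_coefs base_emb p ->
  (forall s : gal_of {:N}, map_poly s p = p) -> exists p0, p = map_poly base_emb p0.
Proof.
move=> int_p fix_p.
have /fin_all_exists[c cE] (l : 'I_(size p)) : exists a, p`_l = base_emb a.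
  by apply: galois_descent => // s; rewrite -coef_map fix_p.
exists (\sum_(l < size p) c l *: 'X^l).
rewrite -[LHS]coefK poly_def rmorph_sum; apply: eq_bigr => l _ /=.
by rewrite map_polyZ map_polyXn cE.
Qed.

End GaloisDescent.

(** * The decomposition group of a specialization *)

(** A Galois-stable subring of [N] with a morphism to [Nt] above [ev]. The
    subring is given by a ring [sp_ring] that maps onto it through [sp_val],
    with kernel contained in that of [sp_red]: a polynomial ring can then play
    the role of the ring generated by the roots, with [sp_val] and [sp_red]
    evaluations, and [sp_act] a substitution lifting the Galois action.
    [sp_separates] is the absence of inertia, and [sp_generates] holds when the
    reductions generate [Nt]. *)
Record specialization (A : comNzRingType) (F k : fieldType)
    (i : {rmorphism A -> F}) (ev : {rmorphism A -> k})
    (N : splittingFieldType F) (Nt : splittingFieldType k) := Specialization {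
  sp_ring : comNzRingType;
  sp_base : {rmorphism A -> sp_ring};
  sp_val : {rmorphism sp_ring -> N};
  sp_red : {rmorphism sp_ring -> Nt};
  sp_act : gal_of {:N} -> {rmorphism sp_ring -> sp_ring};
  sp_val_base : forall a, sp_val (sp_base a) = base_emb i N a;
  sp_red_base : forall a, sp_red (sp_base a) = base_emb ev Nt a;
  sp_red_ker : forall b, sp_val b = 0 -> sp_red b = 0;
  sp_val_act : forall s b, sp_val (sp_act s b) = s (sp_val b);
  sp_integral : forall b, integralOver (base_emb i N) (sp_val b);
  sp_separates : forall s s', s != s' ->
    exists b, sp_red (sp_act s b) != sp_red (sp_act s' b);
  sp_generates : forall u u' : gal_of {:Nt},
    (forall b, u (sp_red b) = u' (sp_red b)) -> u = u'
}.

Section Decomposition.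

Variables (A : comNzRingType) (F k : fieldType).
Variables (i : {rmorphism A -> F}) (ev : {rmorphism A -> k}).
Hypothesis closedA : forall q, integralOver i q -> exists a, q = i a.
Variables (N : splittingFieldType F) (Nt : splittingFieldType k).
Hypothesis galN : galois 1 {:N}.
Hypothesis char0 : [pchar Nt] =i pred0.
Variable S : specialization i ev N Nt.

Local Notation B := (sp_ring S).
Local Notation alpha := (sp_base S).
Local Notation j := (sp_val S).
Local Notation phi := (sp_red S).
Local Notation act := (sp_act S).

Implicit Types (s : gal_of {:N}) (u : gal_of {:Nt}).

Lemma phi_eq b c : j b = j c -> phi b = phi c.
Proof.
move=> eq_bc; apply/eqP; rewrite -subr_eq0 -rmorphB sp_red_ker //.
by rewrite rmorphB eq_bc subrr.
Qed.

Lemma map_phi_eq p q :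
  map_poly j p = map_poly j q -> map_poly phi p = map_poly phi q.
Proof.
move=> eq_pq; apply/polyP => l; rewrite !coef_map; apply: phi_eq.
by rewrite -!coef_map eq_pq.
Qed.

Lemma map_val_base p : map_poly j (map_poly alpha p) = map_poly (base_emb i N) p.
Proof. by rewrite -map_poly_comp; apply: eq_map_poly => a; apply: sp_val_base. Qed.

Lemma map_red_base p : map_poly phi (map_poly alpha p) = map_poly (base_emb ev Nt) p.
Proof. by rewrite -map_poly_comp; apply: eq_map_poly => a; apply: sp_red_base. Qed.

Lemma phi_act1 b : phi (act 1%g b) = phi b.
Proof. by apply: phi_eq; rewrite sp_val_act gal_id. Qed.

Lemma phi_actM s s' b : phi (act (s * s')%g b) = phi (act s' (act s b)).
Proof. by apply: phi_eq; rewrite !sp_val_act galM ?memvf. Qed.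

(** [s] belongs to the decomposition group and induces [u] on the residue
    field. *)
Definition compatible s u := forall b, phi (act s b) = u (phi b).

(** Otherwise some [b] would satisfy [u (phi b) != phi (act s b)] for all [s].
    But the [phi (act s b)] are the roots of a polynomial with coefficients
    in [k], the reduction of the characteristic polynomial of [j b], so [u]
    permutes them. *)
Lemma exists_compatible u : exists s, compatible s u.
Proof.
apply: NNPP => no_s.
pose lam s b := u (phi b) - phi (act s b).
have [b _ lam_b] : exists2 b, True & {in enum {: gal_of {:N}}, forall s, lam s b != 0}.
  apply: additive_simultaneous_nonzero => // [s b c|s _].
    by rewrite /lam !rmorphD /= addrACA opprD.
  apply: NNPP => no_b; apply: no_s; exists s => b; apply/eqP.
  rewrite eq_sym -subr_eq0; apply: contra_notT no_b => lam_b.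
  by exists b.
pose C := \prod_(s : gal_of {:N}) ('X - (act s b)%:P).
have jC : map_poly j C = \prod_(s : gal_of {:N}) ('X - (s (j b))%:P).
  by rewrite map_prod_XsubC; apply: eq_bigr => s _; rewrite sp_val_act.
have [||C0 C0E] := galois_descent_poly closedA galN (p := map_poly j C).
- rewrite jC; apply: integral_coefs_prod => s _.
  apply: integral_coefsB; first exact: integral_coefsX.
  exact/integral_coefsC/integral_gal/sp_integral.
- move=> s; rewrite jC map_prod_XsubC [RHS](reindex_inj (mulIg s)) /=.
  by apply: eq_bigr => s' _; rewrite galM ?memvf.
have phiC : map_poly phi C = map_poly (base_emb ev Nt) C0.
  by rewrite -map_red_base; apply: map_phi_eq; rewrite map_val_base.
have rootC v : root (map_poly phi C) v = [exists s, v == phi (act s b)].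
  rewrite map_prod_XsubC /root horner_prod; apply/prodf_eq0/existsP.
    by case=> s _; rewrite hornerXsubC subr_eq0 => v_eq; exists s.
  by case=> s v_eq; exists s; rewrite ?hornerXsubC ?subr_eq0.
have : root (map_poly phi C) (u (phi b)).
  rewrite phiC -(map_gal_base ev u) -phiC rmorph_root // rootC.
  by apply/existsP; exists 1%g; rewrite phi_act1.
rewrite rootC => /existsP[s].
by rewrite -subr_eq0; apply/negP; apply: lam_b; rewrite mem_enum.
Qed.

Lemma compatible_fun s s' u : compatible s u -> compatible s' u -> s = s'.
Proof.
move=> su s'u; apply/eqP; apply/idPn => /(@sp_separates _ _ _ _ _ _ _ S)[b].
by rewrite su s'u eqxx.
Qed.

Lemma compatible_inj s u u' : compatible s u -> compatible s u' -> u = u'.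
Proof. by move=> su su'; apply: (sp_generates (s0 := S)) => b; rewrite -su su'. Qed.

Lemma compatibleM s u s' u' :
  compatible s u -> compatible s' u' -> compatible (s * s')%g (u * u')%g.
Proof. by move=> su s'u' b; rewrite phi_actM s'u' su galM ?memvf. Qed.

Lemma decomposition_group : exists D : {group gal_of {:N}},
  [/\ D \subset 'Gal({:N} / 1%AS)%g, ('Gal({:Nt} / 1%AS) \isog D)%g,
      forall s, s \in D -> exists u, compatible s u
    & forall u, exists2 s, s \in D & compatible s u].
Proof.
have [d dP] := fin_all_exists exists_compatible.
have inG u : u \in 'Gal({:Nt} / 1%AS)%g by rewrite gal_full inE.
have dM : {in 'Gal({:Nt} / 1%AS)%g &, {morph d : u u' / (u * u')%g}}.
  move=> u u' _ _; apply: compatible_fun (dP _) _.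
  exact: compatibleM (dP u) (dP u').
pose dm := Morphism dM.
exists (dm @* 'Gal({:Nt} / 1%AS))%G; split.
- by apply/subsetP => s _; rewrite gal_full inE.
- apply: sub_isog => //; apply/injmP => u u' _ _ /= eq_d.
  by apply: (compatible_inj (dP u)); rewrite eq_d; apply: dP.
- by move=> s /morphimP[u _ _ ->]; exists u; apply: dP.
- by move=> u; exists (d u); [exact: (mem_morphim dm) | apply: dP].
Qed.

(** Genericity, applied to all pairs of automorphisms at once. *)
Lemma exists_separating : exists b, forall s s', s != s' ->
  phi (act s b) != phi (act s' b).
Proof.
pose lam (e : gal_of {:N} * gal_of {:N}) b := phi (act e.1 b) - phi (act e.2 b).
have [b _ lam_b] : exists2 b, True &
    {in [seq e <- enum {: gal_of {:N} * gal_of {:N}} | e.1 != e.2],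
      forall e, lam e b != 0}.
  apply: additive_simultaneous_nonzero => // [e b c|e].
    by rewrite /lam !rmorphD /= addrACA opprD.
  rewrite mem_filter => /andP[/(@sp_separates _ _ _ _ _ _ _ S)[b] ne_b _].
  by exists b => //; rewrite subr_eq0.
exists b => s s' ne_s; rewrite -subr_eq0.
by apply: (lam_b (s, s')); rewrite mem_filter ne_s mem_enum.
Qed.

(** Integral elements lie in the localization of the image of [j] at the kernel
    of [phi]: with [b] separating, the Lagrange numerator
    [H = \sum_s s(a) \prod_(s' != s) (X - s'(b))] is invariant, so it has
    coefficients in [A], and [H(b) = a \prod_(s' != 1) (b - s'(b))]. *)
Lemma integral_fraction a : integralOver (base_emb i N) a ->
  exists c, exists2 d : B, phi d != 0 & j c = j d * a.
Proof.
move=> int_a; have [b sep_b] := exists_separating.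
pose H := \sum_(s : gal_of {:N}) (s a)%:P * \prod_(s' | s' != s) ('X - (s' (j b))%:P).
have [||H0 H0E] := galois_descent_poly closedA galN (p := H).
- apply: integral_coefs_sum => s _; apply: integral_coefsM.
    exact/integral_coefsC/integral_gal.
  apply: integral_coefs_prod => s' _; apply: integral_coefsB.
    exact: integral_coefsX.
  exact/integral_coefsC/integral_gal/sp_integral.
- move=> s; rewrite rmorph_sum [RHS](reindex_inj (mulIg s)) /=.
  apply: eq_bigr => s1 _; rewrite rmorphM /= map_polyC /= galM ?memvf //.
  congr (_ * _); rewrite map_prod_XsubC [RHS](reindex_inj (mulIg s)) /=.
  apply: eq_big => [s2|s2 _]; first by rewrite (inj_eq (mulIg s)).
  by rewrite galM ?memvf.
exists (map_poly alpha H0).[b], (\prod_(s | s != 1%g) (b - act s b)).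
  rewrite rmorph_prod; apply/prodf_neq0 => s ne_s1.
  by rewrite rmorphB /= subr_eq0 -{1}phi_act1 sep_b // eq_sym.
rewrite -horner_map map_val_base -H0E /H horner_sum (bigD1 1%g) //=.
rewrite [X in _ + X]big1 => [|s ne_s1].
  rewrite addr0 hornerM hornerC gal_id mulrC; congr (_ * _).
  rewrite horner_prod rmorph_prod; apply: eq_bigr => s _.
  by rewrite !hornerE rmorphB /= sp_val_act.
(* for s != 1 the factor of index s' = 1 vanishes at b *)
rewrite hornerM horner_prod (bigD1 1%g) 1?eq_sym //=.
by rewrite gal_id hornerXsubC subrr mul0r mulr0.
Qed.

(** [v] is the value at [a] of the extension of [phi] to fractions whose
    denominator does not reduce to zero. *)
Definition reduces a v :=
  exists c d : B, [/\ phi d != 0, j c = j d * a & phi c = phi d * v].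

Lemma exists_reduces a : integralOver (base_emb i N) a -> exists v, reduces a v.
Proof.
move/integral_fraction=> [c [s nz_s jc]].
by exists (phi c / phi s), c, s; split=> //; rewrite mulrC divfK.
Qed.

Lemma reduces_fun a v w : reduces a v -> reduces a w -> v = w.
Proof.
case=> [c [s [nz_s jc pc]]] [c' [s' [nz_s' jc' pc']]].
have : phi (c * s') = phi (c' * s).
  apply: phi_eq; rewrite !rmorphM jc jc' mulrAC [RHS]mulrAC; congr (_ * _).
  exact: mulrC.
rewrite !rmorphM pc pc' mulrAC [RHS]mulrAC [X in _ = X * _]mulrC.
by apply: mulfI; rewrite mulf_neq0.
Qed.

Lemma reduces_gal s u a v : compatible s u -> reduces a v -> reduces (s a) (u v).
Proof.
move=> su [c [d [nz_d jc pc]]]; exists (act s c), (act s d).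
by rewrite !su fmorph_eq0 !sp_val_act jc pc !rmorphM.
Qed.

(** Clearing denominators turns the factorization of [f] into one over [B], to
    which [phi] applies. *)
Lemma reduces_prod_XsubC (f : {poly A}) (ys : seq N) (red : N -> Nt) :
    map_poly (base_emb i N) f = \prod_(y <- ys) ('X - y%:P) ->
    {in ys, forall y, reduces y (red y)} ->
  map_poly (base_emb ev Nt) f = \prod_(y <- ys) ('X - (red y)%:P).
Proof.
move=> fE red_ys.
have [R [d [nz_d jR phiR]]] : exists R d,
  [/\ phi d != 0, map_poly j R = (j d)%:P * \prod_(y <- ys) ('X - y%:P)
    & map_poly phi R = (phi d)%:P * \prod_(y <- ys) ('X - (red y)%:P)].
  elim: ys {fE} red_ys => [|y ys IHys] red_ys.
    exists 1, 1; rewrite (rmorph1 phi) (rmorph1 j) !big_nil !mulr1 oner_eq0.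
    by split; rewrite ?rmorph1.
  have [|R [d [nz_d jR phiR]]] := IHys.
    by move=> y' ys_y'; apply: red_ys; rewrite inE ys_y' orbT.
  have [c [s [nz_s jc pc]]] := red_ys y (mem_head _ _).
  exists ((s%:P * 'X - c%:P) * R), (s * d); split.
  - by rewrite rmorphM mulf_neq0.
  - rewrite !rmorphM /= jR rmorphB !rmorphM /= map_polyX !map_polyC /= jc big_cons.
    by rewrite !polyCM -mulrBr mulrACA.
  rewrite !rmorphM /= phiR rmorphB !rmorphM /= map_polyX !map_polyC /= pc big_cons.
  by rewrite !polyCM -mulrBr mulrACA.
have : map_poly phi R = map_poly phi (d%:P * map_poly alpha f).
  by apply: map_phi_eq; rewrite rmorphM /= map_polyC map_val_base jR fE.
rewrite phiR rmorphM /= map_polyC map_red_base => /esym.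
by apply: mulfI; rewrite polyC_eq0.
Qed.

End Decomposition.

(** * Discriminants and separability *)

Lemma resultant_neq0_separable (F : fieldType) (p : {poly F}) :
  p != 0 -> resultant p p^`() != 0 -> separable_poly p.
Proof.
move=> nz_p; rewrite resultant_eq0 -leqNgt => le_gcd1.
rewrite unlock coprimep_def eqn_leq le_gcd1 size_poly_gt0 gcdp_eq0.
by rewrite (negPf nz_p).
Qed.

Lemma disc_neq0_separable (F : fieldType) (p : {poly F}) :
  disc p != 0 -> separable_poly p.
Proof.
rewrite /disc !mulf_eq0 !negb_or invr_eq0 lead_coef_eq0 => /andP[/andP[_ nz_p]].
exact: resultant_neq0_separable.
Qed.

(** As neither the leading coefficient of [P] nor, in characteristic 0, that of
    its derivative vanishes at [t], the Sylvester matrices keep their size and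
    the resultant commutes with specialization. *)
Lemma specialize_separable (k : fieldType) (P : {poly {poly k}}) (Delta : {poly k}) t :
    [pchar k] =i pred0 -> (1 < size P)%N ->
    tofrac Delta = disc (over_ratfun P) ->
    Delta.[t] != 0 -> (lead_coef P).[t] != 0 ->
  separable_poly (specialize t P).
Proof.
move=> char0 szP DeltaE nz_Delta nz_lead.
have nz_t (p : {poly k}) : p.[t] != 0 -> p != 0.
  by apply: contraNneq => ->; rewrite horner0.
have nz_natr m : (0 < m)%N -> m%:R != 0 :> k.
  by move/pcharf0P: char0 => ->; rewrite -lt0n.
have szP_gt0 : (0 < (size P).-1)%N by rewrite -ltnS prednK // ltnW.
have lead_deriv : lead_coef P^`() = lead_coef P *+ (size P).-1.
  have coefP' : P^`()`_(size P).-2 = lead_coef P *+ (size P).-1.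
    by rewrite coef_deriv prednK.
  have nz_coef : P^`()`_(size P).-2 != 0.
    apply: contraNneq nz_lead; rewrite coefP' => /(congr1 (horner_eval t))/eqP.
    rewrite /horner_eval hornerMn horner0 -mulr_natr mulf_eq0.
    by rewrite (negPf (nz_natr _ szP_gt0)) orbF.
  have szP' : size P^`() = (size P).-1.
    apply/eqP; rewrite eqn_leq -ltnS prednK ?(ltnW szP) // lt_size_deriv ?nz_t //=.
      by rewrite -(prednK szP_gt0) ltnNge; apply: contraNN nz_coef => /leq_sizeP->.
    by rewrite -size_poly_gt0 ltnW.
  by rewrite -coefP' lead_coefE szP'.
have nz_lead' : (lead_coef P^`()).[t] != 0.
  by rewrite lead_deriv hornerMn -mulr_natr mulf_neq0 ?nz_natr.
have resE : tofrac (resultant P P^`()) =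
    tofrac ((-1) ^+ 'C((size P).-1, 2) * lead_coef P * Delta) :> ratfun k.
  have sz_PF : size (over_ratfun P) = size P.
    by rewrite size_map_poly_id0 // tofrac_eq0 nz_t.
  have lead_PF : lead_coef (over_ratfun P) = tofrac (lead_coef P).
    by rewrite /lead_coef sz_PF coef_map.
  rewrite map_resultant ?tofrac_eq0 ?nz_t // -deriv_map.
  rewrite !rmorphM /= DeltaE /disc lead_PF sz_PF rmorph_sign mulrA.
  rewrite [X in _ = X * _]mulrACA -expr2 sqrr_sign mul1r divff ?mul1r //.
  by rewrite tofrac_eq0 nz_t.
move/eqP: resE; rewrite tofrac_eq => /eqP resE.
apply: resultant_neq0_separable.
  by rewrite map_poly_eq0_id0 // -size_poly_gt0 ltnW.
rewrite deriv_map -(map_resultant (f := horner_eval t)) //.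
by rewrite resE !rmorphM /= rmorph_sign !mulf_neq0 ?signr_eq0.
Qed.

(** * Degrees of irreducible factors and Galois orbits *)

Lemma gal_eq_gens (F : fieldType) (L : splittingFieldType F) (rs : seq L)
    (s s' : gal_of {:L}) :
  <<1 & rs>>%VS = {:L}%VS -> {in rs, s =1 s'} -> s = s'.
Proof.
move=> gen_rs eq_rs; pose E := fixedField [set (s * s'^-1)%g].
have fixE a : (a \in E) = (s a == s' a).
  apply/fixedFieldP/eqP => [|fix_a|eq_a u]; first exact: memvf.
    have := fix_a _ (set11 _); rewrite galM ?memvf // => /(congr1 s').
    by rewrite -(galM (s'^-1)%g s') ?memvf // mulVg gal_id.
  rewrite inE => /eqP ->; rewrite galM ?memvf // eq_a.
  by rewrite -(galM s' (s'^-1)%g) ?memvf // mulgV gal_id.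
have sub_E : (<<1 & rs>> <= E)%VS.
  apply/Fadjoin_seqP; split; first exact: sub1v.
  by move=> a rs_a; rewrite fixE eq_rs.
apply/eqP/gal_eqP => a _; apply/eqP; rewrite -fixE.
by rewrite (subvP sub_E) // gen_rs memvf.
Qed.

Lemma irreducible_eqp_minPoly (F : fieldType) (L : fieldExtType F)
    (q : {poly F}) (a : L) :
  irreducible_poly q -> root (map_poly (in_alg L) q) a ->
  map_poly (in_alg L) q %= minPoly 1 a.
Proof.
case=> _ irr_q qa0; have /polyOver1P[m mE] := minPolyOver 1%AS a.
have := minPoly_dvdp (alg_polyOver 1%AS q) qa0.
rewrite mE dvdp_map eqp_map eqp_sym => /irr_q; apply.
by rewrite -(size_map_poly (in_alg L)) -mE size_minPoly eqSS.
Qed.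

(** An irreducible factor of degree [d] accounts for [d] of the roots, all of
    degree [d]. For [d > 0] this recovers the number of factors of degree [d]
    from the degrees of the roots. *)
Lemma count_roots_of_degree (F : fieldType) (L : fieldExtType F)
    (qs : seq {poly F}) (rs : seq L) d :
    (forall q, q \in qs -> irreducible_poly q) ->
    map_poly (in_alg L) (\prod_(q <- qs) q) %= \prod_(x <- rs) ('X - x%:P) ->
  (count (fun x : L => adjoin_degree 1 x == d) rs =
     d * count (fun q : {poly F} => (size q).-1 == d) qs)%N.
Proof.
elim: qs rs => [|q qs IHqs] rs irr_qs.
  rewrite big_nil rmorph1 eqp_sym => /eqp_size.
  rewrite size_prod_XsubC size_polyC oner_eq0 => -[/size0nil ->].
  by rewrite /= muln0.
rewrite big_cons rmorphM /= => eq_rs.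
(* the roots of q and those of the other factors *)
have [m1 m1E] : {m | map_poly (in_alg L) q %= \prod_(x <- mask m rs) ('X - x%:P)}.
  by apply: dvdp_prod_XsubC; rewrite -(eqp_dvdr _ eq_rs) dvdp_mulr.
have [m2 m2E] : {m | map_poly (in_alg L) (\prod_(q <- qs) q) %=
                     \prod_(x <- mask m rs) ('X - x%:P)}.
  by apply: dvdp_prod_XsubC; rewrite -(eqp_dvdr _ eq_rs) dvdp_mull.
have /seq.permP -> : perm_eq rs (mask m1 rs ++ mask m2 rs).
  apply: prod_XsubC_eq; rewrite big_cat /=; apply/eqP.
  rewrite -eqp_monic ?monicMl ?monic_prod_XsubC //.
  by rewrite -(eqp_ltrans eq_rs) (eqp_trans (eqp_mulr _ m1E)) // eqp_mull.
rewrite count_cat (IHqs (mask m2 rs)) //; last first.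
  by move=> q' qs_q'; apply: irr_qs; rewrite inE qs_q' orbT.
rewrite /= mulnDr; congr (_ + _)%N.
have sz_q : (size q).-1 = size (mask m1 rs).
  by rewrite -(size_map_poly (in_alg L)) (eqp_size m1E) size_prod_XsubC.
have deg_x : {in mask m1 rs, forall x, adjoin_degree 1 x = (size q).-1}.
  move=> x m1_x; have irr_q := irr_qs q (mem_head _ _).
  have /(irreducible_eqp_minPoly irr_q)/eqp_size : root (map_poly (in_alg L) q) x.
    by rewrite (eqp_root m1E) root_prod_XsubC.
  by rewrite size_minPoly size_map_poly => ->.
rewrite (eq_in_count (a2 := fun=> (size q).-1 == d)); last first.
  by move=> x /deg_x /= ->.
case: eqP => [<-|_]; first by rewrite count_predT sz_q muln1.
by rewrite count_pred0 muln0.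
Qed.

(** The orbit is recorded by indices, so that orbits in two different fields can
    be compared. *)
Lemma adjoin_degree_orbit (F : fieldType) (L : splittingFieldType F)
    (n : nat) (x : n.-tuple L) m :
    galois 1 {:L} -> uniq x -> (forall (s : gal_of {:L}), s (tnth x m) \in x) ->
  adjoin_degree 1 (tnth x m) =
    #|[set l | [exists s : gal_of {:L}, s (tnth x m) == tnth x l]]|.
Proof.
move=> galL uniq_x stab_x.
have [|r [_ uniq_r minE]] := galois_factors (sub1v {:L}%AS) galL (tnth x m).
  exact: memvf.
have <- : size r = adjoin_degree 1 (tnth x m).
  apply: succn_inj.
  by rewrite -[RHS]size_minPoly minE size_prod_XsubC size_map.
rewrite -(size_map (fun s : gal_of {:L} => s (tnth x m))) cardE -(size_map (tnth x)).
apply: perm_size; apply: uniq_perm => // [|y].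
  by rewrite map_inj_uniq ?enum_uniq //; apply/tuple_uniqP.
rewrite -root_prod_XsubC -minE; apply/idP/mapP.
  move=> root_y.
  have [s _ <-] :=
    normalField_root_minPoly (sub1v _) (normalFieldf 1) (memvf _) root_y.
  have /tnthP[l lE] := stab_x s; exists l; rewrite // mem_enum inE.
  by apply/existsP; exists s; rewrite lE.
case=> l; rewrite mem_enum inE => /existsP[s /eqP <-] ->.
by rewrite root_minPoly_gal ?sub1v ?memvf // gal_full inE.
Qed.

(** * Monic irreducible polynomials over an integrally closed domain *)

Section Gauss.

Variables (A : idomainType) (F : fieldType) (i : {rmorphism A -> F}).
Hypothesis inj_i : injective i.
Hypothesis closedA : forall q, integralOver i q -> exists a, q = i a.
Variables (N : splittingFieldType F) (galN : galois 1 {:N}).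

Lemma base_emb_inj : injective (base_emb i N).
Proof. exact: inj_comp (fmorph_inj (in_alg N)) inj_i. Qed.

(** Gauss's lemma by integrality: the minimal polynomial of [a] has integral
    coefficients, so it comes from [A] and is a monic divisor of [f] there. *)
Lemma irreducible_minPoly (f : {poly A}) (a : N) :
    f \is monic -> ring_irreducible f -> root (map_poly (base_emb i N) f) a ->
  map_poly (base_emb i N) f = minPoly 1 a.
Proof.
move=> mon_f [_ _ irr_f] fa0.
have int_a : integralOver (base_emb i N) a by exists f.
have [r [_ _ minE]] := galois_factors (sub1v {:N}%AS) galN a (memvf a).
have [||m mE] := galois_descent_poly closedA galN (p := minPoly 1 a).
- rewrite minE big_map; apply: integral_coefs_prod => s _.
  apply: integral_coefsB; first exact: integral_coefsX.
  exact/integral_coefsC/integral_gal.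
- by move=> s; rewrite (fixedPoly_gal (sub1v _)) ?gal_full ?inE ?minPolyOver.
have sz_map p : size (map_poly (base_emb i N) p) = size p.
  by rewrite size_map_inj_poly ?rmorph0 //; apply: base_emb_inj.
have mon_m : m \is monic.
  have := monic_minPoly 1 a; rewrite mE !monicE.
  rewrite lead_coef_map_inj ?rmorph0 //; last exact: base_emb_inj.
  by move/eqP=> lead_m; apply/eqP/base_emb_inj; rewrite lead_m rmorph1.
have divE := Pdiv.RingMonic.rdivp_eq mon_m f.
set q := Pdiv.Ring.rdivp f m in divE; set R := Pdiv.Ring.rmodp f m in divE.
have R0 : R = 0.
  apply/eqP; rewrite -size_poly_eq0 -(sz_map R) size_poly_eq0.
  have dvd_R : minPoly 1 a %| map_poly (base_emb i N) R.
    have -> : R = f - q * m by rewrite [X in X - _]divE addrAC subrr add0r.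
    rewrite rmorphB rmorphM /= -mE; apply: dvdp_sub; last exact: dvdp_mull.
    by apply: minPoly_dvdp => //; rewrite map_poly_comp alg_polyOver.
  apply: contraLR dvd_R => nz_R; apply/negP => /(dvdp_leq nz_R).
  by rewrite mE !sz_map leqNgt Pdiv.Ring.ltn_rmodp monic_neq0.
rewrite R0 addr0 in divE.
case: (irr_f _ _ divE); rewrite poly_unitE => /andP[/size_poly1P[c _ cE] _].
  have : lead_coef f == 1 by rewrite -monicE.
  rewrite divE mE cE lead_coefM lead_coefC (monicP mon_m) mulr1 => /eqP ->.
  by rewrite mul1r.
have := size_minPoly 1 a.
by rewrite mE sz_map cE size_polyC => /eqP; case: (c != 0).
Qed.

End Gauss.

(** * Rational roots of a specialized polynomial *)

Lemma seq_choice (T : eqType) (U : Type) (u0 : U) (R : T -> U -> Prop) (ys : seq T) :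
  (forall y, y \in ys -> exists v, R y v) -> exists g, {in ys, forall y, R y (g y)}.
Proof.
elim: ys => [|y ys IHys] exR; first by exists (fun=> u0).
have [|g gP] := IHys; first by move=> y' ys_y'; apply: exR; rewrite inE ys_y' orbT.
have [v Rv] := exR y (mem_head _ _).
exists (fun z => if z == y then v else g z) => z; rewrite inE.
by case: eqP => [-> | _ /gP].
Qed.

(** Reduction is an equivariant bijection from the conjugates of [a] to the
    roots of the specialization of [f], injective by [sep_f]. A root in [k] is a
    reduction fixed by all of [Gt], hence comes from a conjugate fixed by [D],
    and conversely. *)
Lemma residual_root (A : comNzRingType) (F k : fieldType)
    (i : {rmorphism A -> F}) (ev : {rmorphism A -> k})
    (N : splittingFieldType F) (Nt : splittingFieldType k)
    (S : specialization i ev N Nt) (D : {set gal_of {:N}}) (f : {poly A}) (a : N) :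
    (forall q, integralOver i q -> exists a, q = i a) ->
    galois 1 {:N} -> galois 1 {:Nt} -> [pchar Nt] =i pred0 ->
    (forall s, s \in D -> exists u, compatible S s u) ->
    (forall u, exists2 s, s \in D & compatible S s u) ->
    f \is monic -> map_poly (base_emb i N) f = minPoly 1 a ->
    separable_poly (map_poly ev f) ->
  (exists x, root (map_poly ev f) x) <->
  exists g : gal_of {:N}, forall s, s \in D -> s (g a) = g a.
Proof.
move=> closedA galN galNt char0 D_comp comp_D mon_f fE sep_f.
have [r [_ uniq_r minE]] := galois_factors (sub1v {:N}%AS) galN a (memvf a).
set ys := [seq _ | _ <- r] in uniq_r minE.
have ysE y : (y \in ys) = root (minPoly 1 a) y by rewrite minE root_prod_XsubC.
have [|red redP] := seq_choice 0 (R := reduces S) (ys := ys).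
  move=> y ys_y; apply: exists_reduces => //.
  by exists f => //; rewrite fE -ysE.
have ftE := reduces_prod_XsubC (etrans fE minE) redP.
have uniq_red : uniq [seq red y | y <- ys].
  by rewrite -separable_prod_XsubC big_map -ftE map_poly_comp separable_map.
have root_ft x : root (map_poly ev f) x = (x%:A \in [seq red y | y <- ys]).
  rewrite -root_prod_XsubC big_map -ftE map_poly_comp.
  by rewrite -[x%:A]/(in_alg Nt x) fmorph_root.
have stab_ys (s : gal_of {:N}) y : y \in ys -> s y \in ys.
  rewrite !ysE => root_y.
  have -> : minPoly 1 a = map_poly s (minPoly 1 a).
    by rewrite (fixedPoly_gal (sub1v _)) ?gal_full ?inE ?minPolyOver.
  by rewrite rmorph_root.
split=> [[x] | [g fix_g]].
  rewrite root_ft => /mapP[y ys_y xE].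
  have /mapP[g _ yE] := ys_y; exists g => s /D_comp[u su]; rewrite -yE.
  have := reduces_gal su (redP y ys_y).
  rewrite -xE -[x%:A]/(in_alg Nt x) rmorph_alg => red_sy.
  have eq_red := reduces_fun (redP _ (stab_ys s y ys_y)) red_sy.
  have ys_sy := stab_ys s y ys_y.
  rewrite -[LHS](nth_index y ys_sy) -[RHS](nth_index y ys_y); congr nth; apply/eqP.
  rewrite -(nth_uniq 0 _ _ uniq_red) ?(size_map red) ?index_mem //.
  by rewrite !(nth_map y) ?index_mem // !nth_index // eq_red xE.
have ys_ga : g a \in ys by rewrite ysE root_minPoly_gal ?sub1v ?memvf ?gal_full ?inE.
have : red (g a) \in fixedField 'Gal({:Nt} / 1%AS)%g.
  apply/fixedFieldP => [|u _]; first exact: memvf.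
  have [s Ds su] := comp_D u.
  have := reduces_gal su (redP _ ys_ga); rewrite fix_g // => red_ga.
  by apply: reduces_fun red_ga (redP _ ys_ga).
rewrite (galois_fixedField galNt) => /vlineP[x xE].
by exists x; rewrite root_ft -xE map_f.
Qed.

(** * Construction of the specialization *)

(** The monic polynomial [l^(n-1) P(X / l)], with [l] the leading coefficient of
    [P], has the roots of [P] multiplied by [l]. *)
Lemma monic_scale (A : idomainType) (n : nat) (P : {poly A}) :
    size P = n.+1 -> (0 < n)%N ->
  exists2 P1 : {poly A}, P1 \is monic &
    forall (L : fieldType) (nu : {rmorphism A -> L}) (z : seq L),
      nu (lead_coef P) != 0 ->
      map_poly nu P = nu (lead_coef P) *: \prod_(c <- z) ('X - c%:P) ->
    map_poly nu P1 = \prod_(c <- [seq nu (lead_coef P) * c | c <- z]) ('X - c%:P).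
Proof.
move=> szP n_gt0; set l := lead_coef P.
pose P1 := \poly_(m < n.+1) (if m == n then 1 else P`_m * l ^+ (n.-1 - m)).
exists P1 => [|L nu z nz_l PE].
  by rewrite monicE lead_coef_poly ?eqxx ?oner_eq0.
set c := nu l in nz_l PE *.
set q := \prod_(a <- _) _.
(* both sides are compared through the substitution of c X for X *)
have q_comp : q \Po (c *: 'X) = c ^+ n *: \prod_(a <- z) ('X - a%:P).
  have sz_z : size z = n.
    apply: succn_inj; rewrite -szP -(size_map_poly_id0 (f := nu)) // PE.
    by rewrite size_scale // size_prod_XsubC.
  rewrite /q big_map -sz_z; elim: z {PE q sz_z} => [|a z IHz].
    by rewrite !big_nil comp_polyC scale1r.
  rewrite !big_cons comp_polyM IHz comp_polyB comp_polyX comp_polyC polyCM.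
  by rewrite -mul_polyC -mulrBr mul_polyC -scalerAl -scalerAr scalerA -exprS.
have coef_comp m : (q \Po (c *: 'X))`_m = q`_m * c ^+ m.
  rewrite comp_polyE coef_sum.
  rewrite (eq_bigr (fun e : 'I_(size q) => q`_e * c ^+ e * (m == e)%:R)); last first.
    by move=> e _; rewrite exprZn coefZ coefZ coefXn mulrA.
  case: (ltnP m (size q)) => [lt_m|le_m].
    rewrite (bigD1 (Ordinal lt_m)) //= eqxx mulr1 big1 ?addr0 // => e ne_e.
    by rewrite eq_sym (negPf ne_e : (e == m :> nat) = false) mulr0.
  rewrite big1 => [|e _]; first by rewrite nth_default ?mul0r.
  by rewrite (gtn_eqF (leq_trans (ltn_ord e) le_m)) mulr0.
apply/polyP => m; apply: (mulIf (expf_neq0 m nz_l)).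
rewrite -coef_comp q_comp coefZ coef_map /= coef_poly.
have PmE : nu P`_m = c * (\prod_(a <- z) ('X - a%:P))`_m by rewrite -coef_map PE coefZ.
case: ltnP => [le_mn|lt_nm]; last first.
  have := PmE; rewrite nth_default ?szP // rmorph0 => /esym/eqP.
  by rewrite mulf_eq0 (negPf nz_l) /= => /eqP ->; rewrite mulr0 mul0r.
have [eq_mn|ne_mn] := eqVneq m n.
  rewrite rmorph1 mul1r eq_mn; apply: (mulfI nz_l).
  by rewrite mulrCA -eq_mn -PmE eq_mn -[n]/(n.+1.-1) -szP -lead_coefE mulrC.
have le_m : (m <= n.-1)%N by rewrite -ltnS prednK // ltn_neqAle ne_mn.
rewrite rmorphM rmorphXn /= PmE -[LHS]mulrA -exprD subnK // [LHS]mulrAC -exprS.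
by rewrite prednK.
Qed.

(** The polynomial ring in one variable for each root, with its two evaluations.
    Simplicity of the roots on the residual side rules out inertia: [s != s']
    differ on some [x m], and the two images reduce to different roots. *)
Lemma exists_specialization (A : idomainType) (F k : fieldType)
    (i : {rmorphism A -> F}) (ev : {rmorphism A -> k})
    (N : splittingFieldType F) (Nt : splittingFieldType k)
    (n : nat) (Q : {poly A}) (x : n.-tuple N) (y : n.-tuple Nt) :
    injective i -> [pchar Nt] =i pred0 -> Q \is monic ->
    map_poly (base_emb i N) Q = \prod_(c <- x) ('X - c%:P) ->
    map_poly (base_emb ev Nt) Q = \prod_(c <- y) ('X - c%:P) ->
    uniq y -> <<1 & x>>%VS = {:N}%VS -> <<1 & y>>%VS = {:Nt}%VS ->
  exists (S : specialization i ev N Nt) (p : 'S_n) (e : 'I_n -> sp_ring S),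
    forall m, sp_val S (e m) = tnth x m /\ sp_red S (e m) = tnth y (p m).
Proof.
move=> inj_i char0 mon_Q splitx splity uniq_y gen_x gen_y.
have inj_emb : injective (base_emb i N) := base_emb_inj inj_i (N := N).
have [p pP] := extend_specialization splitx splity inj_emb char0.
have rootx (s : gal_of {:N}) m : exists l, s (tnth x m) = tnth x l.
  suff /tnthP[l lE] : s (tnth x m) \in x by exists l.
  rewrite -root_prod_XsubC -splitx -(map_gal_base i s) rmorph_root //.
  by rewrite splitx root_prod_XsubC mem_tnth.
have /fin_all_exists[pi piP] (s : gal_of {:N}) :
    exists pi, forall m, s (tnth x m) = tnth x (pi m).
  by have /fin_all_exists[g gP] := rootx s; exists g.
pose j : {rmorphism {mpoly A[n]} -> N} := mmap (base_emb i N) (tnth x).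
pose phi : {rmorphism {mpoly A[n]} -> Nt} :=
  mmap (base_emb ev Nt) (fun m => tnth y (p m)).
pose act (s : gal_of {:N}) : {rmorphism {mpoly A[n]} -> {mpoly A[n]}} :=
  mmap (@mpolyC n A) (fun m => 'X_(pi s m)).
have jX m : j 'X_m = tnth x m by rewrite /j /= mmapX mmap1U.
have phiX m : phi 'X_m = tnth y (p m) by rewrite /phi /= mmapX mmap1U.
have actX s m : act s 'X_m = 'X_(pi s m) by rewrite /act /= mmapX mmap1U.
have jC a : j a%:MP = base_emb i N a by rewrite /j /= mmapC.
have phiC a : phi a%:MP = base_emb ev Nt a by rewrite /phi /= mmapC.
have actC s a : act s a%:MP = a%:MP by rewrite /act /= mmapC.
have j_act s b : j (act s b) = s (j b).
  pose g1 : {rmorphism {mpoly A[n]} -> N} := j \o act s.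
  pose g2 : {rmorphism {mpoly A[n]} -> N} := s \o j.
  have g1C a : g1 a%:MP = base_emb i N a by rewrite /g1 /= actC jC.
  have g2C a : g2 a%:MP = base_emb i N a by rewrite /g2 /= jC gal_base.
  rewrite -[LHS]/(g1 b) -[RHS]/(g2 b) (rmorph_mpolyE b g1C) (rmorph_mpolyE b g2C).
  apply: eq_bigr => m _; congr (_ * _); apply: eq_bigr => l _.
  by rewrite /g1 /g2 /= actX !jX piP.
have j_int b : integralOver (base_emb i N) (j b).
  rewrite (rmorph_mpolyE b jC).
  apply: big_ind => [||m _]; [exact: integral0 | exact: integral_add |].
  apply: integral_mul; first exact: integral_id.
  apply: big_ind => [||l _]; [exact: integral1 | exact: integral_mul |].
  elim: (m l) => [|d IHd]; first exact: integral1.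
  rewrite exprS; apply: integral_mul => //.
  by exists Q => //; rewrite splitx root_prod_XsubC jX mem_tnth.
have sep s s' : s != s' -> exists b, phi (act s b) != phi (act s' b).
  move=> ne_s; apply: NNPP => no_b; case/eqP: ne_s.
  apply: (gal_eq_gens gen_x) => _ /tnthP[m ->]; rewrite !piP; congr tnth.
  apply/eqP; apply: contra_notT no_b => ne_pi; exists 'X_m.
  by rewrite !actX !phiX (inj_eq (tuple_uniqP _ uniq_y)) (inj_eq perm_inj).
have gen (u u' : gal_of {:Nt}) : (forall b, u (phi b) = u' (phi b)) -> u = u'.
  move=> eq_u; apply: (gal_eq_gens gen_y) => _ /tnthP[m ->].
  by have := eq_u 'X_((p^-1)%g m); rewrite phiX permKV.
exists (Specialization jC phiC pP j_act j_int sep gen), p, (fun m => 'X_m).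
by move=> m; split; [apply: jX | apply: phiX].
Qed.

(** * The specialized Galois group *)

Lemma splitting_roots (F : fieldType) (L : splittingFieldType F) (p : {poly F}) n :
    is_splitting_field L p -> separable_poly p -> size p = n.+1 ->
  exists z : n.-tuple L,
    [/\ map_poly (in_alg L) p = (lead_coef p)%:A *: \prod_(c <- z) ('X - c%:P),
        uniq z, <<1 & z>>%VS = {:L}%VS &
        forall (s : gal_of {:L}) m, s (tnth z m) \in z].
Proof.
case=> rs p_rs gen_rs sep_p szp.
have sz_rs : size rs == n.
  by rewrite -eqSS -szp -(size_map_poly (in_alg L)) (eqp_size p_rs) size_prod_XsubC.
have root_rs c : (c \in rs) = root (map_poly (in_alg L) p) c.
  by rewrite (eqp_root p_rs) root_prod_XsubC.
exists (Tuple sz_rs); split=> //=.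
- rewrite -[_%:A]/(in_alg L _) -lead_coef_map.
  have /eqpP[[c1 c2] /= /andP[nz_c1 nz_c2] eq_c] := p_rs.
  have := congr1 lead_coef eq_c; rewrite !lead_coefZ lead_coef_prod_XsubC mulr1 => c2E.
  by apply: (scalerI nz_c1); rewrite scalerA c2E.
- by rewrite -separable_prod_XsubC -(eqp_separable p_rs) separable_map.
move=> s m; have : tnth (Tuple sz_rs) m \in rs := mem_tnth m (Tuple sz_rs).
rewrite !root_rs => root_m.
rewrite -(fixedPoly_gal (sub1v _) _ (alg_polyOver 1%AS p) (x := s)).
  by rewrite rmorph_root.
by rewrite gal_full inE.
Qed.

Lemma splitting_galois (F : fieldType) (L : splittingFieldType F) (p : {poly F}) :
  is_splitting_field L p -> separable_poly p -> galois 1 {:L}.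
Proof.
move=> split_p sep_p; apply/splitting_galoisField.
by exists (map_poly (in_alg L) p); rewrite alg_polyOver separable_map.
Qed.

(** Compatible automorphisms act on the matched roots by the same
    permutation. *)
Lemma compatible_roots (A : comNzRingType) (F k : fieldType)
    (i : {rmorphism A -> F}) (ev : {rmorphism A -> k})
    (N : splittingFieldType F) (Nt : splittingFieldType k)
    (S : specialization i ev N Nt) (n : nat) (x : n.-tuple N) (y : n.-tuple Nt)
    (p : 'S_n) (e : 'I_n -> sp_ring S) (s : gal_of {:N}) (u : gal_of {:Nt}) :
    (forall m, sp_val S (e m) = tnth x m /\ sp_red S (e m) = tnth y (p m)) ->
    uniq y -> (forall m, s (tnth x m) \in x) -> compatible S s u ->
  forall l m, (s (tnth x l) == tnth x m) = (u (tnth y (p l)) == tnth y (p m)).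
Proof.
move=> eP uniq_y stab_x su l m.
have [h hE] : exists h, s (tnth x l) = tnth x h.
  by have /tnthP[h ->] := stab_x l; exists h.
have uE h' : s (tnth x l) = tnth x h' -> u (tnth y (p l)) = tnth y (p h').
  case: (eP l) (eP h') => xl yl [xh yh] eq_h.
  by rewrite -yl -su -yh; apply: phi_eq; rewrite sp_val_act xl xh.
apply/eqP/eqP => [/uE // |].
rewrite (uE h hE) => /(tuple_uniqP _ uniq_y)/perm_inj <-.
exact: hE.
Qed.

Lemma adjoin_scale (F : fieldType) (L : fieldExtType F) (a : F) (rs : seq L) :
  a != 0 -> <<1 & rs>>%VS = {:L}%VS ->
  <<1 & [seq (in_alg L a * b)%R | b <- rs]>>%VS = {:L}%VS.
Proof.
move=> nz_a <-; apply/eqP; rewrite eqEsubv; apply/andP; split.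
  apply/Fadjoin_seqP; split=> [|_ /mapP[b rs_b ->]]; first exact: sub1v.
  by rewrite /= mulr_algl memvZ ?seqv_sub_adjoin.
apply/Fadjoin_seqP; split=> [|b rs_b]; first exact: sub1v.
have -> : b = a^-1 *: (in_alg L a * b).
  by rewrite /= mulr_algl scalerA mulVf ?scale1r.
by rewrite memvZ // seqv_sub_adjoin // map_f.
Qed.

(** The discriminants enter only through the separability of the specialized
    polynomials, and [k[T]] through its integral closedness. *)
Lemma specialized_galois_group (A : idomainType) (F k : fieldType)
  (i : {rmorphism A -> F}) (ev : {rmorphism A -> k})
  (inj_i : injective i)
  (closedA : forall q, integralOver i q -> exists a, q = i a)
  (char0 : [pchar k] =i pred0)
  (P : {poly A}) (n : nat) (n_ge1 : (1 <= n)%N) (degP : size P = n.+1)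
  (nz_lead : ev (lead_coef P) != 0)
  (sepP : separable_poly (map_poly i P))
  (sepPt : separable_poly (map_poly ev P))
  (N : splittingFieldType F) (splitN : is_splitting_field N (map_poly i P))
  (Nt : splittingFieldType k) (splitNt : is_splitting_field Nt (map_poly ev P))
  (r : nat) (M : 'I_r -> {group gal_of {:N}})
  (repsM : maximal_class_reps 'Gal({:N} / 1%AS)%G M)
  (f : 'I_r -> {poly A})
  (monic_f : forall i, f i \is monic)
  (irr_f : forall i, ring_irreducible (f i))
  (gen_f : forall m, exists2 a : N,
     root (map_poly (in_alg N) (map_poly i (f m))) a &
     <<1%AS; a>>%VS = fixedField (M m))
  (sep_f : forall m, separable_poly (map_poly ev (f m))) :
  (forall A B : {mset nat},
     factorization_type (map_poly i P) A ->
     factorization_type (map_poly ev P) B ->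
     B <> A -> ~ ('Gal({:Nt} / 1%AS) \isog 'Gal({:N} / 1%AS))%g)
  /\
  (~ ('Gal({:Nt} / 1%AS) \isog 'Gal({:N} / 1%AS))%g <->
   exists m, exists x : k, root (map_poly ev (f m)) x).
Proof.
have galN := splitting_galois splitN sepP.
have galNt := splitting_galois splitNt sepPt.
have char0t : [pchar Nt] =i pred0 by move=> m; rewrite pchar_lalg char0.
have szPF : size (map_poly i P) = n.+1 by rewrite size_map_inj_poly ?rmorph0.
have szPt : size (map_poly ev P) = n.+1 by rewrite size_map_poly_id0.
have leadPF : lead_coef (map_poly i P) = i (lead_coef P).
  by rewrite /lead_coef szPF degP coef_map.
have leadPt : lead_coef (map_poly ev P) = ev (lead_coef P).
  by rewrite /lead_coef szPt degP coef_map.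
have [z [PF_E uniq_z gen_z stab_z]] := splitting_roots splitN sepP szPF.
have [w [Pt_E uniq_w gen_w stab_w]] := splitting_roots splitNt sepPt szPt.
set c := base_emb i N (lead_coef P).
set d := base_emb ev Nt (lead_coef P).
have nz_c : c != 0.
  rewrite /c -(rmorph0 (base_emb i N)) (inj_eq (base_emb_inj inj_i (N := N))).
  by rewrite lead_coef_eq0 -size_poly_gt0 degP.
have nz_d : d != 0 by rewrite fmorph_eq0.
have [Q mon_Q QE] := monic_scale degP n_ge1.
pose x : n.-tuple N := [tuple of [seq c * a | a <- z]].
pose y : n.-tuple Nt := [tuple of [seq d * a | a <- w]].
have splitx : map_poly (base_emb i N) Q = \prod_(a <- x) ('X - a%:P).
  apply: (QE _ _ _ nz_c).
  by rewrite map_base_emb PF_E leadPF.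
have splity : map_poly (base_emb ev Nt) Q = \prod_(a <- y) ('X - a%:P).
  apply: (QE _ _ _ nz_d).
  by rewrite map_base_emb Pt_E leadPt.
have uniq_y : uniq y by rewrite map_inj_uniq //; apply: mulfI.
have [||S [p [e eP]]] := exists_specialization inj_i char0t mon_Q splitx splity uniq_y.
- by apply: adjoin_scale gen_z; rewrite -leadPF lead_coef_eq0 -size_poly_gt0 szPF.
- exact: adjoin_scale gen_w.
have [D [_ isoD D_comp comp_D]] := decomposition_group closedA galN char0t S.
set G := 'Gal({:N} / 1%AS)%G in repsM *.
have Gfull s : s \in G.
  by rewrite -[s \in G]/(s \in 'Gal({:N} / 1%AS)%g) gal_full inE.
have sDG : D \subset G by apply/subsetP.
have isoG : ('Gal({:Nt} / 1%AS) \isog 'Gal({:N} / 1%AS))%g <-> D :=: G.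
  split=> [isoNt | eqDG]; last by rewrite -[X in _ \isog X]eqDG.
  by apply/eqP; rewrite eqEcard sDG -(card_isog isoD) (card_isog isoNt) leqnn.
have stab_x (s : gal_of {:N}) m : s (tnth x m) \in x.
  by rewrite tnth_map rmorphM /= gal_base map_f ?stab_z.
split=> [X Y [qs [irr_qs PF_qs ->]] [qts [irr_qts Pt_qts ->]] neq_YX /isoG eqDG | ].
  have deg_eq m : adjoin_degree 1 (tnth z m) = adjoin_degree 1 (tnth w (p m)).
    rewrite !adjoin_degree_orbit // -[RHS](card_preimset _ (@perm_inj _ p)).
    apply: eq_card => l; rewrite !inE.
    have compE s u : compatible S s u ->
        (s (tnth z m) == tnth z l) = (u (tnth w (p m)) == tnth w (p l)).
      move=> su; have := compatible_roots eP uniq_y (stab_x s) su m l.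
      by rewrite !tnth_map !rmorphM /= !gal_base !(inj_eq (mulfI _)).
    apply/existsP/existsP => [[s eq_s] | [u eq_u]].
      have [|u su] := D_comp s; first by rewrite eqDG.
      by exists u; rewrite -(compE s u su).
    have [s _ su] := comp_D u.
    by exists s; rewrite (compE s u su).
  case: neq_YX; apply/eq_seq_msetP/allP => m _ /=; rewrite !count_map.
  (* no irreducible polynomial has degree 0 *)
  case: (posnP m) => [-> | m_gt0].
    rewrite (eq_in_count (a2 := pred0)); last first.
      by move=> q /irr_qts[sz_q _]; rewrite /= -(subnKC sz_q).
    rewrite [X in _ == X](eq_in_count (a2 := pred0)) ?count_pred0 //.
    by move=> q /irr_qs[sz_q _]; rewrite /= -(subnKC sz_q).
  rewrite -(eqn_pmul2l m_gt0).
  rewrite -(count_roots_of_degree m irr_qts (rs := w)); last first.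
    rewrite -(eqp_ltrans (_ : map_poly (in_alg Nt) (map_poly ev P) %= _)).
      by rewrite Pt_E eqp_scale // -[_%:A]/(in_alg Nt _) leadPt.
    by rewrite eqp_map.
  rewrite -(count_roots_of_degree m irr_qs (rs := z)); last first.
    rewrite -(eqp_ltrans (_ : map_poly (in_alg N) (map_poly i P) %= _)).
      by rewrite PF_E eqp_scale // -[_%:A]/(in_alg N _) leadPF.
    by rewrite eqp_map.
  rewrite -!sum1_count !big_tuple (reindex_inj (@perm_inj _ p)) /=.
  by apply/eqP/eq_bigl => l; rewrite deg_eq.
have f_minPoly m a : root (map_poly (in_alg N) (map_poly i (f m))) a ->
    map_poly (base_emb i N) (f m) = minPoly 1 a.
  by move=> fa0; apply: irreducible_minPoly => //; rewrite map_base_emb.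
have residual m a (fa0 : root (map_poly (in_alg N) (map_poly i (f m))) a) :=
  residual_root closedA galN galNt char0t D_comp comp_D
    (monic_f m) (f_minPoly m a fa0) (sep_f m).
have [maxM coverM _] := repsM.
split=> [not_iso | [m root_m] /isoG eqDG].
  (* the maximal K is the conjugate of some M m by some g, so it fixes g a *)
  have [eqDG|[K maxK sDK]] := maximal_exists sDG.
    by case: not_iso; apply/isoG; rewrite eqDG.
  have [m /imsetP[g _ KE]] := coverM K maxK; exists m.
  have [a fa0 genM] := gen_f m.
  apply/(residual m a fa0); exists g => s /(subsetP sDK).
  rewrite KE => /imsetP[s' Ms' ->].
  rewrite conjgE -galM ?memvf // !mulgA mulgV mul1g galM ?memvf //.
  have /mem_fixedFieldP[_ ->] // : a \in fixedField (M m) by rewrite -genM memv_adjoin.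
have [a fa0 genM] := gen_f m.
have /(residual m a fa0)[g fix_g] := root_m.
have sub_M : (D :^ g^-1 \subset M m)%g.
  rewrite -(gal_fixedField (M m)) -genM galois_connection ?subvf // sub_adjoin1v.
  apply/fixedFieldP => [|_ /imsetP[s Ds ->]]; first exact: memvf.
  rewrite conjgE invgK !galM ?memvf // fix_g //.
  by rewrite -galM ?memvf // mulgV gal_id.
have := proper_subn (maxgroupp (maxM m)); case/negP.
by move: sub_M; rewrite eqDG conjGid.
Qed.

Theorem theorem2p6 (k : fieldType) (char0 : [pchar k] =i pred0)
  (P : {poly {poly k}}) (n : nat) (n_ge1 : (1 <= n)%N) (degP : size P = n.+1)
  (sepP : separable_poly (over_ratfun P))
  (N : splittingFieldType (ratfun k))
  (splitN : is_splitting_field N (over_ratfun P))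
  (G_neq1 : ('Gal({:N} / 1%AS) != 1)%g)
  (Delta : {poly k}) (DeltaE : tofrac Delta = disc (over_ratfun P))
  (r : nat) (M : 'I_r -> {group gal_of {:N}})
  (repsM : maximal_class_reps 'Gal({:N} / 1%AS)%G M)
  (f : 'I_r -> {poly {poly k}})
  (monic_f : forall i, f i \is monic)
  (irr_f : forall i, ring_irreducible (f i))
  (gen_f : forall i, exists2 a : N,
     root (map_poly (in_alg N) (over_ratfun (f i))) a &
     <<1%AS; a>>%VS = fixedField (M i))
  (t : k)
  (good_t : Delta.[t] * (lead_coef P).[t]
              * \prod_(i < r) disc (specialize t (f i)) != 0)
  (Nt : splittingFieldType k)
  (splitNt : is_splitting_field Nt (specialize t P)) :
  (forall A B : {mset nat},
     factorization_type (over_ratfun P) A ->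
     factorization_type (specialize t P) B ->
     B <> A -> ~ ('Gal({:Nt} / 1%AS) \isog 'Gal({:N} / 1%AS))%g)
  /\
  (~ ('Gal({:Nt} / 1%AS) \isog 'Gal({:N} / 1%AS))%g <->
   exists i, exists x : k, root (specialize t (f i)) x).
Proof.
move: good_t; rewrite !mulf_eq0 !negb_or.
case/andP=> /andP[nz_Delta nz_lead] /prodf_neq0 nz_disc.
apply: (specialized_galois_group (i := tofrac (R := {poly k})) (ev := horner_eval t)
          _ (@poly_integrally_closed k) char0 n_ge1 degP nz_lead sepP _
          splitN splitNt repsM monic_f irr_f gen_f).
- by move=> a b /eqP; rewrite tofrac_eq => /eqP.
- by apply: specialize_separable DeltaE nz_Delta nz_lead => //; rewrite degP ltnS.
- by move=> m; apply/disc_neq0_separable/nz_disc.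
Qed.
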